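(* Let $D=(V,A)$ be a finite loopless digraph endowed with $f:A\to\mathbb{Z}\cup\{-\infty\}$ and $g:A\to\mathbb{Z}\cup\{+\infty\}$ with $f\le g$. Let $B$ be an integral $0$-base-polyhedron for which $Q=Q(f,g;B)$ is non-empty. Let $F\subseteq A$ be a subset of edges for which there exists an $F$-dec-min element of $Q\cap\mathbb{Z}^A$. Then there exist a face $B^{\triangledown}$ of $B$ and a pair $(f^*,g^* )$ of integer-valued bounding functions on $A$ with $f\le f^*\le g^*\le g$ such that an element $z\in Q\cap\mathbb{Z}^A$ is $F$-dec-min in $Q\cap\mathbb{Z}^A$ if and only if $z\in Q(f^*,g^*;B^{\triangledown})\cap\mathbb{Z}^A$. Moreover, $0\le g^*(e)-f^*(e)\le1$ for every $e\in F$.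
   Context: For $x\in\mathbb{R}^V$, $\widetilde x(Z)=\sum_{v\in Z}x(v)$. A base-polyhedron is $B'(p)=\{x:\widetilde x(V)=p(V),\ \widetilde x(Z)\ge p(Z)\ \forall Z\subset V\}$ with $p:2^V\to\mathbb{Z}\cup\{-\infty\}$, $p(\emptyset)=0$, $p(V)$ finite, $p(X)+p(Y)\le p(X\cap Y)+p(X\cup Y)$; $0$-base-polyhedron: $p(V)=0$; integral: $p$ integer-valued where finite. For $x:A\to\mathbb{R}$, $\psi_x(v)=\sum_{uv\in A}x(uv)-\sum_{vu\in A}x(vu)$; $Q(f,g;B)=\{x\in\mathbb{R}^A:f\le x\le g,\ \psi_x\in B\}$. For $y,y'\in\mathbb{R}^F$, $y$ is decreasingly smaller than $y'$ if its decreasingly sorted component sequence is lexicographically smaller; $z\in S$ is $F$-dec-min in $S$ if no $z'\in S$ has $z'|_F$ decreasingly smaller than $z|_F$. *)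

(* Defs.v *)
From HB Require Import structures.
From mathcomp Require Import all_boot all_order all_algebra.
From mathcomp Require Import boolp classical_sets constructive_ereal reals.

Set Implicit Arguments.
Unset Strict Implicit.
Unset Printing Implicit Defensive.

Import Order.TTheory GRing.Theory Num.Theory.

Local Open Scope classical_set_scope.
Local Open Scope ring_scope.

Definition int_ereal (R : realType) (a : \bar int) : \bar R :=
  er_map (fun m : int => m%:~R) a.

Section BasePolyhedron.
Variables (R : realType) (V : finType).

Definition supermodular_setfun (p : {set V} -> \bar int) : Prop :=
  [/\ forall X, p X != +oo%E,
      p finset.set0 = 0%E,
      p [set: V]%SET \is a fin_num &
      forall X Y, (p X + p Y <= p (X :&: Y)%SET + p (X :|: Y)%SET)%E].

Definition base_polyhedron (p : {set V} -> \bar int) : set (V -> R) :=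
  [set x | (\sum_(v : V) x v)%:E = int_ereal R (p [set: V]%SET) /\
     forall Z : {set V}, (int_ereal R (p Z) <= (\sum_(v in Z) x v)%:E)%E].

Definition integral_zero_base_polyhedron (B : set (V -> R)) : Prop :=
  exists p : {set V} -> \bar int,
    [/\ supermodular_setfun p, p [set: V]%SET = 0%E & B = base_polyhedron p].

(* The nonempty faces, as sets of minimizers of a linear function; [c = 0]
   gives [B] itself. *)
Definition is_face (B' B : set (V -> R)) : Prop :=
  B' !=set0 /\
  exists c : V -> R,
    B' = [set x | B x /\
      forall y, B y -> \sum_(v : V) c v * x v <= \sum_(v : V) c v * y v].

End BasePolyhedron.

(* A digraph is given by its vertex type [V], its edge type [A] and the two
   end-vertex maps; parallel edges are allowed. *)
Definition loopless (V A : finType) (tail head : A -> V) : Prop :=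
  forall e : A, tail e != head e.

Section Flow.
Variables (R : realType) (V A : finType) (tail head : A -> V).

Definition net_in (x : A -> R) (v : V) : R :=
  \sum_(e : A | head e == v) x e - \sum_(e : A | tail e == v) x e.

(* Functions A -> Z u {-oo} and A -> Z u {+oo} respectively. *)
Definition lower_bounding (f : A -> \bar int) : Prop :=
  forall e, f e != +oo%E.
Definition upper_bounding (g : A -> \bar int) : Prop :=
  forall e, g e != -oo%E.

Definition submodular_flows (f g : A -> \bar int) (B : set (V -> R)) :
    set (A -> R) :=
  [set x | (forall e, (int_ereal R (f e) <= (x e)%:E <= int_ereal R (g e))%E)
           /\ B (net_in x)].

End Flow.

Section DecMin.
Variables (R : realType) (A : finType).

Definition integral_points : set (A -> R) :=
  [set x | forall e, x e \is a Num.int].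

Definition decr_sorted (F : {set A}) (y : A -> R) : seq R :=
  sort (fun a b : R => b <= a) [seq y e | e <- enum F].

Definition decreasingly_smaller (F : {set A}) (y y' : A -> R) : Prop :=
  (decr_sorted F y < decr_sorted F y' :> seqlexi R)%O.

Definition dec_min (F : {set A}) (S : set (A -> R)) (z : A -> R) : Prop :=
  S z /\ forall z', S z' -> ~ decreasingly_smaller F z' z.

End DecMin.

(* Main.v *)
Require Import Defs.
From HB Require Import structures.
From mathcomp Require Import all_boot all_order all_algebra.
From mathcomp Require Import boolp classical_sets constructive_ereal reals.
From mathcomp Require Import zify ring lra.

(** Dec-minimality of integral vectors on [F] amounts to minimizing the separable
    cost [sum_(e in F) N ^ x(e)] with [N > #|F|], which is strictly convex in each
    coordinate of [F].  Suppose [z] is a minimizer.  In the auxiliary graph of [z]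
    (unit changes of the flow along edges, and unit exchanges keeping the net
    in-flow in [B]) there is no negative cycle: a shortest one could be pushed, as
    absence of shortcuts makes its exchanges, ordered by the weight of the cycle up
    to them, successively feasible.  Hence there is a potential [pi], i.e. the
    net in-flow of [z] maximizes [pi] over [B], and each [z(e)] minimizes
    [N ^ t + (pi (head e) - pi (tail e)) * t] over the bounds (without the power
    for [e] outside [F]).  As the cost is the sum of these edge terms minus the
    [pi]-value of the net in-flow, the minimizers are the flows optimal in every
    term: the maximizers of [pi] form a face of [B], and the optimal [t] form an
    interval, which strict convexity shortens to length at most one on [F]. *)

Set Implicit Arguments.
Unset Strict Implicit.
Unset Printing Implicit Defensive.

Import Order.TTheory GRing.Theory Num.Theory.

Local Open Scope classical_set_scope.
Local Open Scope ring_scope.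

(** * Exchanges in integral base polyhedra *)

Section Exchange.
Variables (V : finType) (p : {set V} -> \bar int).
Hypothesis p_supermodular : supermodular_setfun p.

Definition int_base (y : V -> int) : Prop :=
  p [set: V]%SET = (\sum_v y v)%:E /\
  forall Z : {set V}, (p Z <= (\sum_(v in Z) y v)%:E)%E.

Definition tight (y : V -> int) (Z : {set V}) : bool :=
  p Z == (\sum_(v in Z) y v)%:E.

Definition exchangeable (y : V -> int) (u v : V) : bool :=
  [forall Z : {set V}, tight y Z ==> (u \in Z) ==> (v \in Z)].

Definition shift (y : V -> int) (q : V * V) : V -> int :=
  fun w => y w - (w == q.1)%:R + (w == q.2)%:R.

Lemma exchangeableP y u v :
  reflect (forall Z, tight y Z -> u \in Z -> v \in Z) (exchangeable y u v).
Proof.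
apply: (iffP forallP) => [H Z tZ uZ|H Z].
  by move: (H Z); rewrite tZ uZ.
by apply/implyP => tZ; apply/implyP; exact: H.
Qed.

Lemma exchangeablePn y u v :
  reflect (exists2 Z, tight y Z & (u \in Z) && (v \notin Z))
    (~~ exchangeable y u v).
Proof.
rewrite negb_forall; apply: (iffP existsP) => -[Z].
  by rewrite !negb_imply => /and3P[tZ uZ vZ]; exists Z; rewrite ?uZ.
by move=> tZ /andP[uZ vZ]; exists Z; rewrite !negb_imply tZ uZ.
Qed.

Lemma sum_mem (Z : {set V}) (u : V) :
  \sum_(w in Z) (w == u)%:R = (u \in Z)%:R :> int.
Proof.
case: (boolP (u \in Z)) => uZ.
  by rewrite (bigD1 u) //= eqxx big1 ?addr0 // => w /andP[_ /negPf->].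
by rewrite big1 // => w wZ; case: eqP wZ uZ => // -> ->.
Qed.

Lemma sum_shift (Z : {set V}) y q :
  \sum_(w in Z) shift y q w =
  \sum_(w in Z) y w - (q.1 \in Z)%:R + (q.2 \in Z)%:R.
Proof. by rewrite /shift big_split sumrB /= !sum_mem. Qed.

Lemma sum_setT (y : V -> int) : \sum_v y v = \sum_(v in [set: V]%SET) y v.
Proof. by apply: eq_bigl => v; rewrite inE. Qed.

(** A set whose sum drops contains [q.1] but not [q.2]. It is therefore not tight, and by
    integrality it has slack at least one. *)
Lemma shift_base y q :
  int_base y -> exchangeable y q.1 q.2 -> int_base (shift y q).
Proof.
move=> [yT yB] /exchangeableP ex; split.
  by rewrite sum_setT sum_shift !inE subrK -sum_setT.
move=> Z; rewrite sum_shift.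
have := yB Z; have := ex Z; rewrite /tight.
case: (p Z) => [r||] //; rewrite ?leNye // !lee_fin eqe.
case: (q.1 \in Z); case: (q.2 \in Z) => /= H; lia.
Qed.

(** The sums of [y] are modular and dominate the supermodular [p], so equality on [X] and [Y]
    squeezes both other inequalities into equalities. *)
Lemma tightIU y X Y : int_base y -> tight y X -> tight y Y ->
  tight y (X :&: Y)%SET && tight y (X :|: Y)%SET.
Proof.
move=> [_ yB]; rewrite /tight => /eqP tX /eqP tY.
have [_ _ _ /(_ X Y)] := p_supermodular.
have := yB (X :&: Y)%SET; have := yB (X :|: Y)%SET; rewrite tX tY.
have : \sum_(v in X) y v + \sum_(v in Y) y v =
       \sum_(v in (X :&: Y)%SET) y v + \sum_(v in (X :|: Y)%SET) y v.
  rewrite ![\sum_(v in _) y v]big_mkcond -!big_split; apply: eq_bigr => v _ /=.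
  by rewrite !inE; case: (v \in X); case: (v \in Y); rewrite /= ?addr0 ?add0r.
case: (p (X :&: Y)%SET) => [a||] //; case: (p (X :|: Y)%SET) => [b||] //.
rewrite -!EFinD !lee_fin !eqe; lia.
Qed.

Lemma tight_setT y : int_base y -> tight y [set: V]%SET.
Proof. by move=> [yT _]; rewrite /tight yT -sum_setT. Qed.

Lemma tight_set0 y : tight y finset.set0.
Proof. by have [_ p0 _ _] := p_supermodular; rewrite /tight p0 big_set0. Qed.

(* Peeling off the head pair keeps the hypotheses: the tight sets separating
   the other pairs from it contain neither of its elements. *)
Lemma shifts_base y (l : seq (V * V)) : int_base y ->
  all (fun q => exchangeable y q.1 q.2) l ->
  pairwise (fun q r => ~~ exchangeable y r.1 q.2) l ->
  int_base (foldl shift y l).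
Proof.
elim: l y => [//|q l IH] y yB /= /andP[exq exl] /andP[sep pw].
have sB := shift_base yB exq.
have stight (Z : {set V}) : q.2 \notin Z -> tight y Z -> tight (shift y q) Z.
  move=> qZ tZ; have q1 : q.1 \notin Z.
    by apply: contra qZ; exact: (exchangeableP _ _ _ exq _ _).
  by rewrite /tight sum_shift (negPf qZ) (negPf q1) subr0 addr0.
have tights (Z : {set V}) : q.1 \notin Z -> q.2 \notin Z -> tight (shift y q) Z -> tight y Z.
  by move=> q1 q2; rewrite /tight sum_shift (negPf q1) (negPf q2) subr0 addr0.
apply: IH => //.
  apply/allP => r rl; apply/exchangeableP => Z tZ rZ.
  have /exchangeablePn[T tT /andP[rT qT]] := allP sep _ rl.
  have q1T : q.1 \notin T.
    by apply: contra qT; exact: (exchangeableP _ _ _ exq _ _).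
  have /andP[tI _] := tightIU sB tZ (stight _ qT tT).
  have := exchangeableP _ _ _ (allP exl _ rl) (Z :&: T)%SET.
  rewrite !inE rZ rT => /(_ _ isT)/andP[]// .
  by apply: tights; rewrite // !inE negb_and ?qT ?q1T orbT.
move: pw; apply: sub_in_pairwise (allss l) => r r' rl r'l /exchangeablePn[T tT /andP[rT r'T]].
(* [T] separates [r'] from [r] but may meet [q]. Its intersection with [T'], which avoids [q.2],
   stays tight after the shift. *)
have /exchangeablePn[T' tT' /andP[rT' qT']] := allP sep _ r'l.
apply/exchangeablePn; exists (T :&: T')%SET; last first.
  by rewrite !inE rT rT' (negPf r'T).
have /andP[tI _] := tightIU yB tT tT'.
by apply: stight => //; rewrite inE negb_and qT' orbT.
Qed.

Lemma foldl_shift y l w :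
  foldl shift y l w = y w + \sum_(q <- l) ((w == q.2)%:R - (w == q.1)%:R).
Proof.
elim: l y => [|q l IH] y /=; first by rewrite big_nil addr0.
by rewrite IH big_cons /shift; ring.
Qed.

(** The least tight set [D u] containing [u] consists of the [v] exchangeable from [u]. Monotonicity
    of [h] makes the level set the union of the [D u] of its members. *)
Lemma level_set_tight d (T : porderType d) y (h : V -> T) (t : T) : int_base y ->
  (forall u v, exchangeable y u v -> (h v <= h u)%O) ->
  tight y [set v | (h v <= t)%O]%SET.
Proof.
move=> yB mono.
pose D u := (\bigcap_(Z : {set V} | tight y Z && (u \in Z)) Z)%SET.
have tD u : tight y (D u).
  apply: (big_ind (tight y)); first exact: tight_setT.
    by move=> X Y tX tY; have /andP[] := tightIU yB tX tY.
  by move=> Z /andP[].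
have -> : [set v | (h v <= t)%O]%SET = (\bigcup_(u | (h u <= t)%O) D u)%SET.
  apply/setP => v; rewrite inE; apply/idP/bigcupP => [hv|[u hu]].
    by exists v => //; apply/bigcapP => Z /andP[].
  move=> /bigcapP vD; apply: le_trans hu; apply: mono.
  by apply/exchangeableP => Z tZ uZ; apply: vD; rewrite tZ.
apply: (big_ind (tight y)) => //; first exact: tight_set0.
by move=> X Y tX tY; have /andP[] := tightIU yB tX tY.
Qed.

End Exchange.

(** * Potentials of weighted digraphs *)

Section Graph.
Variables (R : realType) (V K : finType) (src dst : K -> V) (ok : pred K).
Variable w : K -> R.

Fixpoint walk (u : V) (s : seq K) (v : V) : bool :=
  if s is a :: s' then [&& ok a, src a == u & walk (dst a) s' v] else u == v.

Definition weight (s : seq K) : R := \sum_(a <- s) w a.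

Lemma weight_cat s t : weight (s ++ t) = weight s + weight t.
Proof. exact: big_cat. Qed.

Lemma weight_cons a s : weight (a :: s) = w a + weight s.
Proof. exact: big_cons. Qed.

Lemma walk_cat u s t v :
  walk u (s ++ t) v <-> exists2 m, walk u s m & walk m t v.
Proof.
elim: s u => [|a s IH] u /=.
  by split=> [H|[m /eqP->]//]; exists u.
split=> [/and3P[-> -> /IH[m sm mt]]|[m /and3P[-> -> sm] mt]]; first by exists m.
by apply/IH; exists m.
Qed.

Lemma walk_ok u s v : walk u s v -> all ok s.
Proof. by elim: s u => //= a s IH u /and3P[-> _ /IH]. Qed.

Lemma nuniq_split (s : seq K) : ~~ uniq s ->
  exists s1 a s2 s3, s = s1 ++ (a :: s2) ++ (a :: s3).
Proof.
elim: s => //= a s IH; rewrite negb_and negbK => /orP[|/IH].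
  by case/splitPr => s1 s2; exists [::], a, s1, s2.
by move=> [s1 [b [s2 [s3 ->]]]]; exists (a :: s1), b, s2, s3.
Qed.

Lemma walk_split_cycle u s1 a s2 s3 v : walk u (s1 ++ (a :: s2) ++ (a :: s3)) v ->
  walk (src a) (a :: s2) (src a) /\ walk u (s1 ++ (a :: s3)) v.
Proof.
move=> /walk_cat[m us1 /walk_cat[m' ms2 ms3]].
move: (ms2) (ms3) => /= /and3P[oka /eqP Em ms2'] /and3P[_ /eqP Em' ms3'].
split; first by rewrite oka eqxx /= Em'.
by apply/walk_cat; exists m => //=; rewrite oka Em eqxx.
Qed.

Lemma sum_src_dst u s v x : walk u s v ->
  \sum_(a <- s) ((src a == x)%:R - (dst a == x)%:R) =
  (u == x)%:R - (v == x)%:R :> int.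
Proof.
elim: s u => [|a s IH] u /=; first by move/eqP->; rewrite big_nil subrr.
by move=> /and3P[_ /eqP<- /IH E]; rewrite big_cons E; ring.
Qed.

Hypothesis no_neg : forall u s, walk u s u -> 0 <= weight s.

(** A repeated arc encloses a closed walk of nonnegative weight, which can be cut out. *)
Lemma walk_shorten u s v : walk u s v ->
  exists s', [/\ uniq s', walk u s' v & weight s' <= weight s].
Proof.
have [n] := ubnP (size s); elim: n s => // n IH s /ltnSE sn us.
have [us'|/nuniq_split[s1 [a [s2 [s3 E]]]]] := boolP (uniq s); first by exists s.
move: us sn; rewrite E => /walk_split_cycle[c us]; rewrite !size_cat /= => sn.
have [|s' [us' ws' le]] := IH (s1 ++ a :: s3) _ us.
  by rewrite size_cat /=; lia.
exists s'; split=> //; apply: le_trans le _.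
by rewrite !weight_cat -cat_cons weight_cat lerD2l lerDr; exact: no_neg c.
Qed.

(** Take for [pi v] the least weight of a walk from anywhere to [v]. The minimum exists because only
    walks of at most [#|K|] arcs compete after shortening. *)
Lemma potential : exists pi : V -> R, forall a, ok a -> pi (dst a) <= pi (src a) + w a.
Proof.
have min_walk v : exists m : R, (exists u s, walk u s v /\ weight s = m) /\
    forall u s, walk u s v -> m <= weight s.
  pose P (x : V * #|K|.-bseq K) := walk x.1 x.2 v.
  have P0 : P (v, [bseq]) by rewrite /P /=.
  case: (arg_minP (fun x : V * #|K|.-bseq K => weight x.2) P0) => -[u s] Pus mn.
  exists (weight s); split; first by exists u, s.
  move=> u' s' /walk_shorten[s'' [uq ws'' /(le_trans _)]]; apply.
  have sz : (size s'' <= #|K|)%N by rewrite -(card_uniqP uq) max_card.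
  exact: (mn (u', Bseq sz)).
have [pi Hpi] := choice min_walk.
exists pi => a oka; have [[u [s [us Es]]] _] := Hpi (src a).
have [_ /(_ u (s ++ [:: a]))] := Hpi (dst a).
rewrite weight_cat weight_cons Es /weight big_nil addr0; apply.
by apply/walk_cat; exists (src a) => //=; rewrite oka !eqxx.
Qed.

End Graph.

(** * Optimal integral submodular flows *)

Section Optimality.
Variables (R : realType) (V A : finType) (tail head : A -> V).
Variables (p : {set V} -> \bar int) (f g : A -> \bar int).
Hypothesis p_supermodular : supermodular_setfun p.
Variable phi : A -> int -> R.
Hypothesis phi_convex : forall e k, phi e k *+ 2 <= phi e (k + 1) + phi e (k - 1).

Definition int_net_in (x : A -> int) (v : V) : int :=
  \sum_(e | head e == v) x e - \sum_(e | tail e == v) x e.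

Definition int_flow (x : A -> int) : Prop :=
  (forall e, (f e <= (x e)%:E <= g e)%E) /\ int_base p (int_net_in x).

Definition cost (x : A -> int) : R := \sum_e phi e (x e).

Variable z : A -> int.
Hypothesis z_flow : int_flow z.

(* Arcs of the auxiliary graph of [z]: [inl (u, v)] exchanges [v] for [u] in
   [B], and [inr (e, b)] increases ([b = true]) or decreases the flow on [e]. *)
Let arc : finType := (V * V + A * bool)%type.

(** An edge arc raises the net in-flow at its source and lowers it at its target, an exchange does
    the reverse. With these opposite signs the two kinds agree around a closed walk. *)
Let src (a : arc) : V :=
  match a with inl q => q.1 | inr (e, b) => if b then head e else tail e end.

Let dst (a : arc) : V :=
  match a with inl q => q.2 | inr (e, b) => if b then tail e else head e end.

Let ok (a : arc) : bool :=
  match a with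
  | inl q => exchangeable p (int_net_in z) q.1 q.2
  | inr (e, b) => if b then ((z e + 1)%:E <= g e)%E else (f e <= (z e - 1)%:E)%E
  end.

Let step (b : bool) : int := if b then 1 else -1.

Let w (a : arc) : R :=
  if a is inr (e, b) then phi e (z e + step b) - phi e (z e) else 0.

Let dir (a : arc) (e : A) : int :=
  if a is inr (e', b) then (e == e')%:R * step b else 0.

Let is_exch (a : arc) : bool := if a is inl _ then true else false.

Let push (s : seq arc) (e : A) : int := z e + \sum_(a <- s) dir a e.

Let pushE s e : uniq s ->
  push s e = z e + (inr (e, true) \in s)%:R - (inr (e, false) \in s)%:R.
Proof.
move=> us; rewrite /push big_uniq //= -addrA; congr (_ + _).
rewrite big_mkcond big_sumType /= big1 ?add0r; last by move=> ? _; case: ifP.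
rewrite (eq_bigr (fun q : A * bool =>
  (e == q.1)%:R * (if inr (q.1, q.2) \in s then step q.2 else 0))); last first.
  by move=> [e' b] _ /=; case: ifP; rewrite ?mulr0.
rewrite -(pair_bigA _ (fun e' b =>
  (e == e')%:R * (if inr (e', b) \in s then step b else 0))) /=.
rewrite (bigD1 e) //= [X in _ + X]big1 ?addr0 => [|e' /negPf e'e]; last first.
  by rewrite big1 // => b _; rewrite [e == e']eq_sym e'e mul0r.
by rewrite big_bool /= eqxx !mul1r; do 2!case: (_ \in s).
Qed.

Let push_bounds s e : uniq s -> all ok s -> (f e <= (push s e)%:E <= g e)%E.
Proof.
move=> us /allP oks; have /andP[fz zg] := z_flow.1 e; rewrite pushE //.
have := oks (inr (e, true)); have := oks (inr (e, false)).
case: (_ \in s) => [/(_ isT)/= H1|_]; case: (_ \in s) => [/(_ isT)/= H2|_] /=;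
  rewrite ?subr0 ?addr0 ?addrK ?fz ?zg ?H1 ?H2 ?andbT //=.
  by apply: le_trans zg; rewrite lee_fin; lia.
by apply: le_trans fz _; rewrite lee_fin; lia.
Qed.

(** If both arcs of an edge occur, they cancel in the flow, while their joint weight is nonnegative
    by convexity. On all other edges equality holds. *)
Let push_cost s : uniq s -> cost (push s) <= cost z + weight w s.
Proof.
move=> us; rewrite /weight big_uniq //= [X in _ + X]big_mkcond big_sumType /=.
rewrite big1 ?add0r; last by move=> ? _; case: ifP.
rewrite (eq_bigr (fun q : A * bool => if inr (q.1, q.2) \in s
  then phi q.1 (z q.1 + step q.2) - phi q.1 (z q.1) else 0)); last by case.
rewrite -(pair_bigA _ (fun e b => if inr (e, b) \in s
  then phi e (z e + step b) - phi e (z e) else 0)) /=.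
rewrite -big_split /=; apply: ler_sum => e _; rewrite big_bool /= pushE //.
have := phi_convex e (z e).
case: (_ \in s); case: (_ \in s); rewrite /= ?subr0 ?addr0 ?addrK; lra.
Qed.

Let net_dir a v : ~~ is_exch a ->
  int_net_in (dir a) v = (src a == v)%:R - (dst a == v)%:R.
Proof.
case: a => [//|[e b]] _; rewrite /int_net_in /=.
have H (h : A -> V) : \sum_(e0 | h e0 == v) (e0 == e)%:R * step b = (h e == v)%:R * step b.
  rewrite big_mkcond (bigD1 e) //= eqxx big1 ?addr0 => [|e' /negPf->]; last by rewrite mul0r if_same.
  by case: ifP; rewrite ?mul1r ?mul0r.
by rewrite !H; case: (b) => /=; ring.
Qed.

(** Around a closed walk the indicators of sources and targets cancel, so the change caused by the
    edge arcs is the sum of the exchanges. *)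
Let net_push s u v : walk src dst ok u s u ->
  int_net_in (push s) v = int_net_in z v +
    \sum_(a <- s | is_exch a) ((v == dst a)%:R - (v == src a)%:R).
Proof.
move=> ws; have := sum_src_dst v ws; rewrite subrr (bigID is_exch) /= => E.
have -> : \sum_(a <- s | is_exch a) ((v == dst a)%:R - (v == src a)%:R) =
   \sum_(a <- s | ~~ is_exch a) ((src a == v)%:R - (dst a == v)%:R) :> int.
  apply/eqP; rewrite eq_sym -subr_eq0 -sumrN addrC; apply/eqP; rewrite -[RHS]E.
  by congr (_ + _); apply: eq_bigr => a _; rewrite opprB ![v == _]eq_sym.
rewrite -(eq_bigr _ (fun a => @net_dir a v)) /int_net_in sumrB.
have H (h : A -> V) : \sum_(e | h e == v) push s e = \sum_(e | h e == v) z e +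
    \sum_(a <- s | ~~ is_exch a) \sum_(e | h e == v) dir a e.
  rewrite exchange_big -big_split /=; apply: eq_bigr => e _; congr (_ + _).
  by rewrite [LHS](bigID is_exch) /= big1 ?add0r // => -[].
by rewrite !H; ring.
Qed.

Let split_nth2 (s : seq arc) (i j : nat) : (i < j < size s)%N ->
  forall a0, exists t, s = take i s ++ nth a0 s i :: t ++ nth a0 s j :: drop j.+1 s /\
    take j s = take i s ++ nth a0 s i :: t.
Proof.
move=> /andP[ij js] a0; exists (take (j - i.+1) (drop i.+1 s)).
have E : take j s = take i s ++ nth a0 s i :: take (j - i.+1) (drop i.+1 s).
  rewrite -{1}(cat_take_drop i s) take_cat size_take (ltn_trans ij js).
  rewrite ltnNge (ltnW ij) /= (drop_nth a0) ?(ltn_trans ij js) //.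
  by have -> : (j - i)%N = (j - i.+1).+1 by lia.
split=> //; rewrite -cat_cons catA -E -drop_nth ?cat_take_drop //.
Qed.

(** * Pushing a shortest negative cycle *)

Section ShortestNegativeCycle.
Variables (u : V) (s : seq arc).
Hypothesis cyc : walk src dst ok u s u.
Hypothesis neg : weight w s < 0.
Hypothesis shorter : forall u' s', (size s' < size s)%N ->
  walk src dst ok u' s' u' -> 0 <= weight w s'.

(** A repeated arc would split the cycle into two shorter closed walks, one of them negative. *)
Let shortest_uniq : uniq s.
Proof.
apply/negPn/negP => /nuniq_split[s1 [a [s2 [s3 E]]]]; move: cyc neg shorter.
rewrite E => /walk_split_cycle[c1 c2] ng sh.
have := sh _ _ _ c1; have := sh _ _ _ c2.
rewrite !size_cat /= => /(_ ltac:(lia)) H1 /(_ ltac:(lia)) H2.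
by move: ng H1 H2; rewrite !(weight_cat, weight_cons); lra.
Qed.

Let a0 : arc := inl (u, u).
Let at_ i := nth a0 s i.
Let W i := weight w (take i s).
Let before (i j : nat) : bool := (W j < W i) || ((W j == W i) && (j <= i)%N).

(** If [i < j], the shortcut replaces the stretch from [i] to [j] of the cycle. The result is
    shorter, hence nonnegative, so the stretch is negative and [W j < W i]. If [j < i], the shortcut
    closes up the stretch between them, so [W j <= W i], and position decides a tie. *)
Let shortcut_before i j : (i < size s)%N -> (j < size s)%N ->
  is_exch (at_ i) -> is_exch (at_ j) -> i != j ->
  exchangeable p (int_net_in z) (src (at_ i)) (dst (at_ j)) ->
  ~~ before j i.
Proof.
move=> si sj xi xj ij ex.
have wi : w (at_ i) = 0 by move: xi; case: (at_ i).
have wj : w (at_ j) = 0 by move: xj; case: (at_ j).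
have shc m s1 s2 m' : walk src dst ok m s1 (src (at_ i)) ->
    walk src dst ok (dst (at_ j)) s2 m' ->
    walk src dst ok m (s1 ++ inl (src (at_ i), dst (at_ j)) :: s2) m'.
  by move=> H1 H2; apply/walk_cat; exists (src (at_ i)) => //=; rewrite ex eqxx.
rewrite /before; move: ij; rewrite neq_ltn => /orP[ij|ji].
  have [|t [Es Et]] := @split_nth2 s i j _ a0; first by rewrite ij.
  have := cyc; rewrite Es => /walk_cat[m1 c1] /= /and3P[_ /eqP E1]
    /walk_cat[m2 _] /= /and3P[_ _ c2].
  rewrite -E1 in c1.
  have := shorter _ (shc _ _ _ _ c1 c2).
  have := neg; rewrite /W Et {1}Es !(weight_cat, weight_cons).
  move: (congr1 size Es); rewrite !(size_cat, size_take, size_drop) /= size_cat /= size_drop.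
  move=> sE; rewrite -/(at_ i) -/(at_ j) wi wj => ng /(_ ltac:(lia)) /= sh.
  rewrite negb_or negb_and -leNgt; apply/andP; split; first by lra.
  by apply/orP; left; apply/eqP; lra.
have [|t [Es Et]] := @split_nth2 s j i _ a0; first by rewrite ji.
have := cyc; rewrite Es => /walk_cat[m1 c1] /= /and3P[_ /eqP E1]
    /walk_cat[m2 c3] /= /and3P[_ /eqP E2 c2].
rewrite -E2 in c3.
have := shorter _ (shc _ [::] t _ (eqxx _) c3).
move: (congr1 size Es); rewrite !(size_cat, size_take, size_drop) /= size_cat /= size_drop.
move=> sE /(_ ltac:(lia)).
rewrite /W Et !(weight_cat, weight_cons) -/(at_ j) wj /= => sh.
rewrite negb_or negb_and -leNgt; apply/andP; split; first by lra.
by apply/orP; right; rewrite -ltnNge.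
Qed.

Lemma shortest_cycle_push : exists x, int_flow x /\ cost x < cost z.
Proof.
exists (push s); split; last first.
  by apply: le_lt_trans (push_cost shortest_uniq) _; rewrite gtrDl.
split=> [e|]; first by apply: push_bounds shortest_uniq (walk_ok cyc).
pose I := sort before [seq i <- iota 0 (size s) | is_exch (at_ i)].
have memI i : i \in I = (i < size s)%N && is_exch (at_ i).
  by rewrite mem_sort mem_filter mem_iota /= add0n andbC.
have tot : total before.
  by move=> i j; rewrite /before; case: (ltgtP (W i) (W j)) => //= _; exact: leq_total.
have tr : transitive before.
  move=> j i k; rewrite /before => /orP[ij|/andP[/eqP ij ij']] /orP[jk|/andP[/eqP jk jk']].
  - by rewrite (lt_trans jk ij).
  - by rewrite jk ij.
  - by rewrite -ij jk.
  - by rewrite jk ij eqxx (leq_trans jk' ij') orbT.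
have pwI : pairwise before I by rewrite -sorted_pairwise ?sort_sorted.
have uI : uniq I by rewrite sort_uniq filter_uniq ?iota_uniq.
pose l := [seq (src (at_ i), dst (at_ i)) | i <- I].
(* The total change does not depend on the order of the exchanges, so they may be applied in the
   order [I] that keeps each one feasible. *)
have -> : int_net_in (push s) = foldl (@shift V) (int_net_in z) l.
  apply/funext => v; rewrite (net_push _ cyc) foldl_shift; congr (_ + _).
  rewrite (big_nth a0) big_mkord -(big_mkord (fun i => is_exch (at_ i))
    (fun i => (v == dst (at_ i))%:R - (v == src (at_ i))%:R)).
  rewrite -big_filter /index_iota subn0 big_map /=.
  by apply: perm_big; rewrite perm_sym perm_sort.
apply: shifts_base z_flow.2 _ _ => //.
  apply/allP => _ /mapP[i + ->] /=; rewrite memI => /andP[si].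
  by have := allP (walk_ok cyc) _ (mem_nth a0 si); rewrite -/(at_ i); case: (at_ i).
rewrite pairwise_map; move: pwI uI; rewrite uniq_pairwise => pwI uI.
have : pairwise [rel i j | (i != j) && before i j] I by rewrite pairwise_relI uI.
apply: (sub_in_pairwise (P := [pred i | (i < size s)%N && is_exch (at_ i)]));
  last by apply/allP => i; rewrite memI.
move=> i j; rewrite !inE => /andP[si xi] /andP[sj xj] /= /andP[ij].
by apply: contraL; rewrite eq_sym in ij; exact: shortcut_before.
Qed.
End ShortestNegativeCycle.

Hypothesis z_opt : forall x, int_flow x -> cost z <= cost x.

Lemma optimal_potential : exists pi : V -> R,
  [/\ forall u v, exchangeable p (int_net_in z) u v -> pi v <= pi u,
      forall e, ((z e + 1)%:E <= g e)%E ->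
        phi e (z e) <= phi e (z e + 1) + (pi (head e) - pi (tail e)) &
      forall e, (f e <= (z e - 1)%:E)%E ->
        phi e (z e) <= phi e (z e - 1) - (pi (head e) - pi (tail e))].
Proof.
have [u s|pi Hpi] := @potential R V arc src dst ok w.
  (* Induction on the length: a negative closed walk would be a shortest one, and pushing it would
     contradict optimality. *)
  have [n] := ubnP (size s); elim: n u s => // n IH u s /ltnSE sn us.
  rewrite leNgt; apply/negP => ng.
  have [|x [xf]] := @shortest_cycle_push u s us ng.
    by move=> u' s' ss'; apply: IH; apply: leq_trans ss' sn.
  by rewrite ltNge z_opt.
exists pi; split=> [u v uv|e ze|e ze].
- by have := Hpi (inl (u, v)) uv; rewrite /= addr0.
- by have := Hpi (inr (e, true)) ze; rewrite /=; lra.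
- by have := Hpi (inr (e, false)) ze; rewrite /=; lra.
Qed.

End Optimality.

(** * Inequalities from level sets and from the lexicographic order *)

(** Summation by parts over the values of [pi]: raising the threshold from one value [pi v1] to the
    next, [M], subtracts [M - pi v1] times a nonnegative level sum. *)
Lemma level_sum_ge0_dot_le0 (R : realType) (V : finType) (pi d : V -> R) :
  \sum_v d v = 0 -> (forall t, 0 <= \sum_(v | pi v <= t) d v) ->
  \sum_v pi v * d v <= 0.
Proof.
move=> d0 lev.
have below M : \sum_(v | pi v <= M) (pi v - M) * d v <= 0.
  have [n] := ubnP #|[pred v | pi v < M]|; elim: n M => // n IH M /ltnSE cM.
  have [/existsP[v0 v0M]|no] := boolP [exists v, pi v < M]; last first.
    rewrite big1 // => v vM; have -> : pi v = M; last by rewrite subrr mul0r.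
    apply/eqP; rewrite eq_le vM leNgt; apply: contra no => vM'.
    by apply/existsP; exists v.
  case: (@arg_maxP _ R V v0 (fun v => pi v < M) pi v0M) => v1 v1M mx.
  have lt_le v : (pi v < M) = (pi v <= pi v1).
    by apply/idP/idP => [|/le_lt_trans]; [exact: mx|apply].
  have /IH : (#|[pred v | (pi v < pi v1)%R]| < n)%N.
    apply: leq_trans cM; apply: proper_card; apply/properP; split.
      by apply/fintype.subsetP => v; rewrite !inE => /lt_trans; apply.
    by exists v1; rewrite !inE // ltxx.
  have := mulr_ge0 (ltW (_ : 0 < M - pi v1)) (lev (pi v1)).
  rewrite subr_gt0 => /(_ v1M); rewrite mulr_sumr => H1 H2.
  rewrite (bigID (fun v => pi v < M)) /= [X in _ + X]big1 ?addr0; last first.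
    by move=> v /andP[h1 h2]; rewrite (_ : pi v = M) ?subrr ?mul0r //;
      apply/eqP; rewrite eq_le h1 leNgt.
  rewrite (eq_bigl (fun v => pi v <= pi v1)); last first.
    by move=> v; rewrite -lt_le andbC; case: ltP => //= /ltW.
  have -> : \sum_(v | pi v <= pi v1) (pi v - M) * d v =
     \sum_(v | pi v <= pi v1) (pi v - pi v1) * d v -
     \sum_(v | pi v <= pi v1) (M - pi v1) * d v.
    by rewrite -sumrB; apply: eq_bigr => v _; ring.
  lra.
(* Any upper bound of [pi] would do: its contribution is multiplied by the total of [d], which is
   zero. *)
pose M := \sum_v `|pi v|.
have piM v : pi v <= M.
  by rewrite /M (bigD1 v) //= (le_trans (ler_norm _)) // lerDl sumr_ge0.
have := below M; rewrite (eq_bigl xpredT) => [|v]; last exact: piM.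
have -> : \sum_v (pi v - M) * d v = \sum_v pi v * d v - M * \sum_v d v.
  by rewrite mulr_sumr -sumrB; apply: eq_bigr => v _; ring.
by rewrite d0 mulr0 subr0.
Qed.

(** At the first difference [x < y], all that remains of [s] is at most [x]. It contributes at most
    [n] times [h x], less than [h y] alone. *)
Lemma lexi_sum_lt (R : realType) (n : nat) (h : R -> R) (s t : seq R) :
  (forall a b, a \is a Num.int -> b \is a Num.int -> a < b -> h a *+ n < h b) ->
  (forall a b, a \is a Num.int -> b \is a Num.int -> a <= b -> h a <= h b) ->
  (forall a, 0 <= h a) ->
  sorted (fun a b => b <= a) s -> {in s, forall a, a \is a Num.int} ->
  {in t, forall a, a \is a Num.int} -> size s = size t -> (size s <= n)%N ->
  (s < t :> seqlexi R)%O -> \sum_(a <- s) h a < \sum_(a <- t) h a.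
Proof.
move=> hn hm h0; elim: s t => [|x s IH] [|y t] //= ss si ti [st] sn.
rewrite ltxi_cons => /andP[]; rewrite le_eqVlt => /orP[/eqP xy|xy _].
  rewrite xy lexx /= => lst; rewrite !big_cons ltrD2l.
  apply: IH => //; first exact: path_sorted ss.
  - by move=> a as_; apply: si; rewrite inE as_ orbT.
  - by move=> a at_; apply: ti; rewrite inE at_ orbT.
  - exact: ltnW.
have xi : x \is a Num.int by apply: si; rewrite mem_head.
have yi : y \is a Num.int by apply: ti; rewrite mem_head.
have H : \sum_(a <- x :: s) h a <= h x *+ (size s).+1.
  rewrite big_cons mulrS lerD2l.
  have : all (fun a => a <= x) s
    by apply: order_path_min ss => b a c H1 H2; exact: le_trans H1.
  have : {in s, forall a, a \is a Num.int}.
    by move=> a as_; apply: si; rewrite inE as_ orbT.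
  elim: (s) => [|a s' IH'] s'i /=; first by rewrite big_nil.
  move=> /andP[ax s'x]; rewrite big_cons mulrS; apply: lerD.
    by apply: hm => //; apply: s'i; rewrite mem_head.
  by apply: IH' => // b bs; apply: s'i; rewrite inE bs orbT.
apply: (le_lt_trans H); apply: le_lt_trans (lt_le_trans (hn _ _ xi yi xy) _).
  by rewrite ler_wpMn2l.
by rewrite big_cons lerDl sumr_ge0.
Qed.

(** * Decreasing minimality as cost minimization *)

Section PowerCost.
Variables (R : realType) (A : finType) (F : {set A}).

(* The base exceeds [#|F|], so one component at level [k + 1] outweighs
   [#|F|] components at level [k]. *)
Definition power_cost (e : A) (k : int) : R :=
  if e \in F then #|F|.+2%:R ^ k else 0.

Let N_gt0 : 0 < #|F|.+2%:R :> R. Proof. by rewrite ltr0n. Qed.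
Let N_neq0 : #|F|.+2%:R != 0 :> R. Proof. by rewrite pnatr_eq0. Qed.

(** With base [N], the second difference at [k] is [N ^ (k - 1)] times the square of [N - 1]. *)
Lemma power_cost_strictly_convex e k : e \in F ->
  power_cost e k *+ 2 < power_cost e (k + 1) + power_cost e (k - 1).
Proof.
rewrite /power_cost => ->.
set N : R := #|F|.+2%:R; set a := N ^ (k - 1).
have aE : N ^ k = a * N by rewrite -{1}(subrK 1 k) expfzDr // expr1z.
have a0 : 0 < a by rewrite exprz_gt0.
have N1 : 0 < N - 1 by rewrite subr_gt0 ltr1n.
rewrite expfzDr // expr1z aE -subr_gt0.
rewrite (_ : _ - _ = a * (N - 1) ^+ 2) ?mulr_gt0 ?exprn_gt0 //; ring.
Qed.

Lemma power_cost_convex e k :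
  power_cost e k *+ 2 <= power_cost e (k + 1) + power_cost e (k - 1).
Proof.
have [eF|eF] := boolP (e \in F); first exact/ltW/power_cost_strictly_convex.
by rewrite /power_cost (negPf eF) mul0rn addr0.
Qed.

Let sum_decr_sorted (x : A -> int) :
  \sum_(a <- decr_sorted F (fun e => (x e)%:~R : R)) #|F|.+2%:R ^ Num.floor a =
  cost power_cost x.
Proof.
rewrite (perm_big _ (permEl (perm_sort _ _))) big_map big_enum /= big_mkcond.
by apply: eq_bigr => e _; rewrite /power_cost intrKfloor.
Qed.

Let smaller_cost_lt (x y : A -> int) :
  decreasingly_smaller F (fun e => (x e)%:~R : R) (fun e => (y e)%:~R) ->
  cost power_cost x < cost power_cost y.
Proof.
rewrite -!sum_decr_sorted; apply: (@lexi_sum_lt R #|F|).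
- move=> _ _ /intrP[a ->] /intrP[b ->]; rewrite ltr_int !intrKfloor => ab.
  apply: (@lt_le_trans _ _ (#|F|.+2%:R ^ (a + 1))).
    by rewrite expfzDr // expr1z -[X in X < _]mulr_natr ltr_pM2l ?exprz_gt0 // ltr_nat ltnS.
  by rewrite ler_eXz2l ?ltr1n // lezD1.
- move=> _ _ /intrP[a ->] /intrP[b ->]; rewrite ler_int !intrKfloor => ab.
  by rewrite ler_eXz2l ?ltr1n.
- by move=> a; rewrite exprz_ge0 // ltW.
- by apply: sort_sorted => a b; exact: le_total.
- by move=> a; rewrite mem_sort => /mapP[e _ ->]; rewrite intr_int.
- by move=> a; rewrite mem_sort => /mapP[e _ ->]; rewrite intr_int.
- by rewrite !size_sort !size_map.
- by rewrite size_sort size_map -cardE.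
Qed.

(** The converse comes from totality of the lexicographic order: equal sorted sequences have equal
    costs. *)
Lemma decreasingly_smallerE (x y : A -> int) :
  decreasingly_smaller F (fun e => (x e)%:~R : R) (fun e => (y e)%:~R) <->
  cost power_cost x < cost power_cost y.
Proof.
split=> [|xy]; first exact: smaller_cost_lt.
rewrite /decreasingly_smaller ltNge; apply/negP; rewrite le_eqVlt.
case/orP => [/eqP E|/smaller_cost_lt]; last by rewrite ltNge (ltW xy).
by move: xy; rewrite -!sum_decr_sorted E ltxx.
Qed.

End PowerCost.

(** * Intervals of optimal values on a single edge *)

Section EdgeRange.
Variable R : realType.

(** The increments of [h] strictly increase, so all those after a nonnegative one are positive. *)
Lemma strictly_convex_lt (h : int -> R) (k t : int) :
  (forall j, h j *+ 2 < h (j + 1) + h (j - 1)) ->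
  h k <= h (k + 1) -> k + 1 < t -> h k < h t.
Proof.
move=> cv h1 kt.
have -> : t = k + 1 + (absz (t - (k + 2))%R).+1%:Z by lia.
move: (absz _) => n {kt}.
have incr m : h (k + 1 + m%:Z) < h (k + 1 + m.+1%:Z).
  elim: m => [|m IH].
    by have := cv (k + 1); rewrite addr0 addrK; lra.
  have := cv (k + 1 + m.+1%:Z).
  have -> : k + 1 + m.+1%:Z + 1 = k + 1 + m.+2%:Z by lia.
  have -> : k + 1 + m.+1%:Z - 1 = k + 1 + m%:Z by lia.
  lra.
elim: n => [|n IH]; first by apply: le_lt_trans h1 _; have := incr 0; rewrite addr0.
exact: lt_trans IH (incr _).
Qed.

(** Beyond the neighbours of [k] the values are strictly larger, and strict convexity forbids ties
    at both neighbours. The interval is thus [k] with at most one neighbour. *)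
Lemma strictly_convex_range (f g : \bar int) (h : int -> R) (k : int) :
  (f <= k%:E <= g)%E -> (forall j, h j *+ 2 < h (j + 1) + h (j - 1)) ->
  (((k + 1)%:E <= g)%E -> h k <= h (k + 1)) ->
  ((f <= (k - 1)%:E)%E -> h k <= h (k - 1)) ->
  exists a b : int, [/\ (f <= a%:E)%E, a <= b <= a + 1, (b%:E <= g)%E &
    forall t : int, (f <= t%:E <= g)%E -> h k <= h t /\ (h t <= h k <-> a <= t <= b)].
Proof.
move=> /andP[fk kg] cv up dn.
have up2 t : (t%:E <= g)%E -> k + 1 < t -> h k < h t.
  move=> tg kt; apply: strictly_convex_lt => //; apply: up.
  by apply: le_trans tg; rewrite lee_fin ltW.
have dn2 t : (f <= t%:E)%E -> t < k - 1 -> h k < h t.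
  (* Reflecting [h] turns the left side into the right one. *)
  move=> ft tk; have := @strictly_convex_lt (fun j => h (- j)) (- k) (- t).
  rewrite !opprK opprD opprK; apply; [|apply: dn|lia].
    by move=> j; have := cv (- j); rewrite opprB opprD addrC [- j + 1]addrC.
  by apply: le_trans ft _; rewrite lee_fin ltW.
pose a := if (f <= (k - 1)%:E)%E && (h (k - 1) <= h k) then k - 1 else k.
pose b := if ((k + 1)%:E <= g)%E && (h (k + 1) <= h k) then k + 1 else k.
exists a, b; rewrite /a /b; split.
- by case: ifP => // /andP[].
- case: ifP => [/andP[_ h1]|_]; case: ifP => [/andP[_ h2]|_]; try lia.
  by exfalso; have := cv k; lra.
- by case: ifP => // /andP[].
move=> t /andP[ft tg].
have [tk|tk|Et] := ltgtP t (k - 1).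
- have lt := dn2 _ ft tk; split; first exact: ltW.
  rewrite leNgt lt /=; split=> // /andP[]; case: ifP => _; lia.
- have [tk'|tk'|Et] := ltgtP t (k + 1).
  + have -> : t = k by lia.
    by split=> //; split=> // _; case: ifP => _; case: ifP => _; lia.
  + have lt := up2 _ tg tk'; split; first exact: ltW.
    rewrite leNgt lt /=; split=> // /andP[_]; case: ifP => _; lia.
  + subst t; rewrite tg; split; first exact: up.
    split=> [->|] /=; first by case: ifP => _; lia.
    by case: (h _ <= _) => // /andP[_]; lia.
- subst t; rewrite ft; split; first exact: dn.
  split=> [->|] /=; first by case: ifP => _; lia.
  by case: (h _ <= _) => // /andP[]; lia.
Qed.

(** For a nonzero slope only [k] is optimal: a feasible [t] on one side makes the neighbour of [k]
    there feasible, which fixes the sign of [c] against [t]. Slope zero leaves everything from [f]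
    to [g], possibly with infinite ends. *)
Lemma linear_range (f g : \bar int) (c : R) (k : int) :
  f != +oo%E -> g != -oo%E -> (f <= k%:E <= g)%E ->
  (((k + 1)%:E <= g)%E -> 0 <= c) -> ((f <= (k - 1)%:E)%E -> 0 <= - c) ->
  exists a b : \bar int, [/\ (f <= a)%E, (a <= b)%E, (b <= g)%E,
    a != +oo%E /\ b != -oo%E &
    forall t : int, (f <= t%:E <= g)%E ->
      c * k%:~R <= c * t%:~R /\ (c * t%:~R <= c * k%:~R <-> (a <= t%:E <= b)%E)].
Proof.
move=> fy gy /andP[fk kg] up dn.
have [->|c0] := eqVneq c 0.
  exists f, g; split=> // [|t ->]; first exact: le_trans kg.
  by rewrite !mul0r.
exists k%:E, k%:E; split=> // t /andP[ft tg]; rewrite !lee_fin -eq_le.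
have [tk|tk|->] := ltgtP t k; last by [].
- have cn : c < 0.
    by rewrite lt_neqAle c0 -oppr_ge0 dn // (le_trans ft) // lee_fin; lia.
  rewrite !ler_nM2l // !ler_int ltW //; by split=> //; rewrite leNgt tk; split.
- have cp : 0 < c.
    by rewrite lt_neqAle eq_sym c0 up // (le_trans _ tg) // lee_fin; lia.
  rewrite !ler_pM2l // !ler_int ltW //; by split=> //; rewrite leNgt tk; split.
Qed.

End EdgeRange.

(** * Integral points as integer-valued functions, and maximizers of a potential *)

Section Integral.
Variables (R : realType) (V A : finType) (tail head : A -> V).

Let intr_fun T (x : T -> int) : T -> R := fun i => (x i)%:~R.

Lemma int_ereal_le (a : \bar int) (m : int) :
  (int_ereal R a <= (m%:~R)%:E)%E = (a <= m%:E)%E.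
Proof. by case: a => [r||] //=; rewrite ?leNye // !lee_fin ler_int. Qed.

Lemma int_ereal_ge (a : \bar int) (m : int) :
  ((m%:~R)%:E <= int_ereal R a)%E = (m%:E <= a)%E.
Proof. by case: a => [r||] //=; rewrite ?leey // !lee_fin ler_int. Qed.

Lemma base_polyhedron_int (p : {set V} -> \bar int) (y : V -> int) :
  base_polyhedron p (intr_fun y) <-> int_base p y.
Proof.
rewrite /base_polyhedron /int_base /= -(rmorph_sum (intr : int -> R)).
have -> : ((\sum_v y v)%:~R%:E = int_ereal R (p [set: V]%SET)) <->
          (p [set: V]%SET = (\sum_v y v)%:E).
  case: (p _) => [r||] //=; split=> // -[].
    by move/intr_inj->.
  by move->.
by split=> -[pT H]; split=> // Z; have := H Z;
  rewrite -(rmorph_sum (intr : int -> R)) int_ereal_le.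
Qed.

Lemma net_in_int (x : A -> int) :
  net_in tail head (intr_fun x) = intr_fun (int_net_in tail head x).
Proof.
by apply/funext => v; rewrite /net_in /intr_fun rmorphB /= !rmorph_sum.
Qed.

Lemma submodular_flows_int f g (p : {set V} -> \bar int) (x : A -> int) :
  submodular_flows tail head f g (base_polyhedron p) (intr_fun x) <->
  int_flow tail head p f g x.
Proof.
rewrite /submodular_flows /int_flow /= net_in_int.
split=> -[b /base_polyhedron_int yB]; split=> // e; move: (b e);
  by rewrite /intr_fun int_ereal_le int_ereal_ge.
Qed.

Lemma integral_points_int (x : A -> R) : integral_points x ->
  exists y : A -> int, x = intr_fun y.
Proof.
move=> xi; exists (fun e => Num.floor (x e)); apply/funext => e.
by rewrite /intr_fun floorK.
Qed.

Lemma int_integral_points (x : A -> int) : integral_points (intr_fun x).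
Proof. by move=> e; exact: intr_int. Qed.

Lemma dot_net_in (pi : V -> R) (x : A -> R) :
  \sum_v pi v * net_in tail head x v = \sum_e (pi (head e) - pi (tail e)) * x e.
Proof.
have H (h : A -> V) : \sum_v pi v * (\sum_(e | h e == v) x e) = \sum_e pi (h e) * x e.
  rewrite (partition_big h xpredT) //=; apply: eq_bigr => v _.
  by rewrite mulr_sumr; apply: eq_bigr => e /eqP->.
under eq_bigr do rewrite mulrBr.
by rewrite sumrB !H -sumrB; apply: eq_bigr => e _; rewrite mulrBl.
Qed.

(** The lower level sets of [pi] are tight for [y], so [x - y] has nonnegative sum on each of them
    and total zero. *)
Lemma exchange_potential_max (p : {set V} -> \bar int) (pi : V -> R)
    (y : V -> int) (x : V -> R) :
  supermodular_setfun p -> int_base p y ->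
  (forall u v, exchangeable p y u v -> pi v <= pi u) ->
  base_polyhedron p x -> \sum_v pi v * x v <= \sum_v pi v * (y v)%:~R.
Proof.
move=> sp yB mono [xT xB].
rewrite -subr_le0 -sumrB.
rewrite (eq_bigr (fun v => pi v * (x v - (y v)%:~R))) => [|v _]; last by rewrite mulrBr.
apply: level_sum_ge0_dot_le0 => [|t].
  by apply/eqP; rewrite sumrB subr_eq0 -(rmorph_sum (intr : int -> R)) -eqe xT yB.1.
rewrite sumrB subr_ge0 -(rmorph_sum (intr : int -> R)) -lee_fin.
have := xB [set v | pi v <= t]%SET.
rewrite (eqP (level_set_tight sp t yB mono)) /=.
have sE (T : nmodType) (h : V -> T) :
    \sum_(v in [set v | pi v <= t]%SET) h v = \sum_(v | pi v <= t) h v.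
  by apply: eq_bigl => v; rewrite inE.
by rewrite !sE.
Qed.

End Integral.

(** * Construction of the bounds and the face *)

Lemma edge_optimal_range (R : realType) (A : finType) (F : {set A})
    (f g : \bar int) (c : R) (e : A) (k : int) :
  let h t := power_cost R F e t + c * t%:~R in
  f != +oo%E -> g != -oo%E -> (f <= k%:E <= g)%E ->
  (((k + 1)%:E <= g)%E -> h k <= h (k + 1)) ->
  ((f <= (k - 1)%:E)%E -> h k <= h (k - 1)) ->
  exists ab : \bar int * \bar int,
    [/\ [/\ (f <= ab.1)%E, (ab.1 <= ab.2)%E & (ab.2 <= g)%E],
        ab.1 != +oo%E /\ ab.2 != -oo%E,
        e \in F -> (0 <= ab.2 - ab.1 <= 1)%E &
        forall t : int, (f <= t%:E <= g)%E ->
          h k <= h t /\ (h t <= h k <-> (ab.1 <= t%:E <= ab.2)%E)].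
Proof.
move=> h fy gy fkg up dn; have [eF|eF] := boolP (e \in F).
  have cv j : h j *+ 2 < h (j + 1) + h (j - 1).
    have := power_cost_strictly_convex R j eF.
    by rewrite /h !rmorphD rmorphN /=; lra.
  have [a [b [fa ab bg H]]] := strictly_convex_range fkg cv up dn.
  exists (a%:E, b%:E); split=> //=.
  - by split=> //; rewrite lee_fin; case/andP: ab.
  - by move=> _; rewrite -EFinB !lee_fin; lia.
have hE t : h t = c * t%:~R by rewrite /h /power_cost (negPf eF) add0r.
have [||a [b [fa ab bg aby H]]] := linear_range (c := c) fy gy fkg.
- by move=> /up; rewrite !hE rmorphD /=; lra.
- by move=> /dn; rewrite !hE rmorphB /=; lra.
by exists (a, b); split=> // t; rewrite !hE; exact: H.
Qed.

Theorem theorem6p6 (R : realType) (V A : finType) (tail head : A -> V)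
    (hD : loopless tail head)
    (f g : A -> \bar int)
    (hf : lower_bounding f) (hg : upper_bounding g)
    (hfg : forall e, (f e <= g e)%E)
    (B : set (V -> R)) (hB : integral_zero_base_polyhedron B)
    (hQ : submodular_flows tail head f g B !=set0)
    (F : {set A})
    (hF : exists z, dec_min F
            (submodular_flows tail head f g B `&` @integral_points R A) z) :
  exists (B' : set (V -> R)) (f' g' : A -> \bar int),
    [/\ is_face B' B,
        [/\ lower_bounding f', upper_bounding g' &
            forall e, [/\ (f e <= f' e)%E, (f' e <= g' e)%E
                        & (g' e <= g e)%E]],
        forall z : A -> R,
          (submodular_flows tail head f g B `&` @integral_points R A) z ->
          (dec_min F
             (submodular_flows tail head f g B `&` @integral_points R A) z
           <-> (submodular_flows tail head f' g' B'
                  `&` @integral_points R A) z) &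
        forall e, e \in F -> (0 <= g' e - f' e <= 1)%E].

Proof.
have [p [sp pT BE]] := hB; subst B.
have [z0R [[z0f z0i] z0min]] := hF.
have [z0 z0E] := integral_points_int z0i; subst z0R.
have flow0 := (submodular_flows_int _ _ _ _ _ _ _).1 z0f.
have opt x : int_flow tail head p f g x -> cost (power_cost R F) z0 <= cost (power_cost R F) x.
  move=> xf; rewrite leNgt; apply/negP => /decreasingly_smallerE.
  apply: z0min; split; last exact: int_integral_points.
  exact/submodular_flows_int.
have [pi [mono up dn]] := optimal_potential sp (@power_cost_convex R A F) flow0 opt.
pose delta e := pi (head e) - pi (tail e).
pose h e t := power_cost R F e t + delta e * t%:~R.
have /choice[ab abP] e := @edge_optimal_range R A F (f e) (g e) (delta e) e (z0 e)
  (hf e) (hg e) (flow0.1 e)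
  ltac:(by move=> /up; rewrite rmorphD /delta /=; lra)
  ltac:(by move=> /dn; rewrite rmorphB /delta /=; lra).
pose dot (x : V -> R) := \sum_v pi v * x v.
(* The potential terms added on the edges sum to the [pi]-value of the net in-flow. *)
have costE x : cost (power_cost R F) x =
    \sum_e h e (x e) - dot (fun v => (int_net_in tail head x v)%:~R).
  have := dot_net_in tail head pi (fun e => (x e)%:~R).
  by rewrite net_in_int /dot => ->; rewrite /h big_split /= addrK.
have maxB y : base_polyhedron p y -> dot y <= dot (fun v => (int_net_in tail head z0 v)%:~R).
  exact: exchange_potential_max sp flow0.2 mono.
have cE (y : V -> R) : \sum_v - pi v * y v = - dot y.
  by rewrite -sumrN; apply: eq_bigr => v _; rewrite mulNr.
(* A face is a set of minimizers, so the maximizers of [pi] are obtained from [- pi]. *)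
exists [set y | base_polyhedron p y /\ forall y', base_polyhedron p y' ->
    \sum_v - pi v * y v <= \sum_v - pi v * y' v].
exists (fun e => (ab e).1), (fun e => (ab e).2); split.
- split; last by exists (fun v => - pi v).
  exists (fun v => (int_net_in tail head z0 v)%:~R); split.
    exact/base_polyhedron_int/flow0.2.
  by move=> y yB; rewrite !cE lerN2 maxB.
- by split=> e; have [? [? ?] _ _] := abP e.
- move=> zR [zf /integral_points_int[z zE]]; subst zR.
  have flowz := (submodular_flows_int _ _ _ _ _ _ _).1 zf.
  pose y v : R := (int_net_in tail head z v)%:~R.
  have yB : base_polyhedron p y by exact/base_polyhedron_int/flowz.2.
  have hz e : h e (z0 e) <= h e (z e) /\
      (h e (z e) <= h e (z0 e) <-> ((ab e).1 <= (z e)%:E <= (ab e).2)%E).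
    by have [_ _ _ /(_ _ (flowz.1 e))] := abP e.
  have sum_le : \sum_e h e (z0 e) <= \sum_e h e (z e).
    by apply: ler_sum => e _; exact: (hz e).1.
  have maxy := maxB _ yB.
  (* Since [z0] is cheapest, being dec-min means costing no more than [z0]. *)
  apply: (@iff_trans _ (cost (power_cost R F) z <= cost (power_cost R F) z0)).
    split=> [[_ zmin]|zz0].
      by rewrite leNgt; apply/negP => /decreasingly_smallerE; exact: zmin.
    split; first by split=> //; exact: int_integral_points.
    move=> xR [xf /integral_points_int[x xE]]; subst xR => /decreasingly_smallerE.
    by rewrite ltNge (le_trans zz0) // opt //; apply/submodular_flows_int; exact: xf.
  (* [z0] minimizes the edge sum and maximizes [dot], so [z] costs no more exactly if it is optimal
     in both. *)
  rewrite !costE -/y; split=> [zz0|[[zab [_ ymin]] _]].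
    split; last exact: int_integral_points.
    split=> [e|]; last first.
      rewrite net_in_int; split=> // y' y'B; rewrite !cE lerN2.
      by apply: le_trans (maxB _ y'B) _; lra.
    rewrite int_ereal_le int_ereal_ge; apply/(hz e).2.
    (* The other edges already contribute at least their minima, which leaves no room for an excess
       on [e]. *)
    have : \sum_(e' | e' != e) h e' (z0 e') <= \sum_(e' | e' != e) h e' (z e').
      by apply: ler_sum => e' _; exact: (hz e').1.
    have : \sum_e h e (z e) <= \sum_e h e (z0 e) by lra.
    by rewrite (bigD1 e) //= [leRHS](bigD1 e) //=; lra.
  have : \sum_e h e (z e) <= \sum_e h e (z0 e).
    apply: ler_sum => e _; apply/(hz e).2.
    by have := zab e; rewrite int_ereal_le int_ereal_ge.
  have := ymin _ ((base_polyhedron_int R p _).2 flow0.2).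
  by rewrite net_in_int !cE lerN2 -/y; lra.
- by move=> e eF; have [_ _ /(_ eF)] := abP e.
Qed.
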